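(* Let $\Omega$ be a finite set, let $\mathcal{F}$ be its power set, let $\mathcal{P}$ be the set of all probability measures on $(\Omega,\mathcal{F})$, let $H$ be an affine set of (finite) signed measures on $(\Omega,\mathcal{F})$, and suppose that $\mathcal{M}:=\mathcal{P}\cap H$ is nonempty. a) There exists a measure $q\in\mathcal{M}$ with $p'\ll q$ for all $p'\in\mathcal{M}$. b) Let $q\in\mathcal{M}$ with $p'\ll q$ for all $p'\in\mathcal{M}$, and let $\varphi\colon[0,\infty)\to\mathbb{R}$ be a convex function with $\varphi(1)=0$ and $\varphi'_+(0)=-\infty$. Then, for $p\in\mathcal{M}$, the following statements are equivalent. (i) $p$ is an extreme point of $\mathcal{M}$. (ii) For every $p'\in\mathcal{M}\setminus\{p\}$, it holds $$\lim_{\lambda\uparrow1}\frac{D_\varphi(\lambda p+(1-\lambda)p'\,\|\,q)-D_\varphi(p\,\|\,q)}{1-\lambda}=-\infty.$$ (iii) $p$ is a strict local maximizer of the function $\mathcal{M}\to\mathbb{R}$, $p'\mapsto D_\varphi(p'\,\|\,q)$.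
   Context: An affine set $H$ is a subset of the vector space of signed measures that contains $\lambda\mu+(1-\lambda)\nu$ for all $\mu,\nu\in H$ and $\lambda\in\mathbb{R}$. An extreme point of a convex set $\mathcal{C}$ of probability measures is a $p\in\mathcal{C}$ such that $p=\lambda p'+(1-\lambda)p''$ with $p',p''\in\mathcal{C}$ and $\lambda\in(0,1)$ implies $p'=p''=p$. We write $p\ll q$ for absolute continuity and $\frac{\mathrm{d}p}{\mathrm{d}q}\colon\Omega\to[0,\infty)$ for the Radon-Nikodym density. For a convex function $\varphi\colon[0,\infty)\to\mathbb{R}$ with $\varphi(1)=0$ and $p,q\in\mathcal{P}$ with $p\ll q$, the $\varphi$-divergence of $p$ with respect to $q$ is $D_\varphi(p\,\|\,q):=\int_\Omega\varphi\big(\frac{\mathrm{d}p}{\mathrm{d}q}\big)\,\mathrm{d}q$. Moreover, $\varphi'_+(0):=\lim_{s\downarrow0}\frac{\varphi(s)-\varphi(0)}{s}\in[-\infty,\infty)$. $\mathcal{M}$ carries the topology inherited from the finite-dimensional space $\mathbb{R}^\Omega$; $p$ is a strict local maximizer of $F\colon\mathcal{M}\to\mathbb{R}$ if there is a relatively open neighborhood $U\subseteq\mathcal{M}$ of $p$ with $F(p')<F(p)$ for all $p'\in U\setminus\{p\}$. *)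

(* Defs.v *)
From HB Require Import structures.
From mathcomp Require Import all_boot all_order all_algebra.
From mathcomp Require Import all_classical all_reals all_analysis.

Set Implicit Arguments.
Unset Strict Implicit.
Unset Printing Implicit Defensive.

Import Order.TTheory GRing.Theory Num.Theory.
Import numFieldNormedType.Exports.

Local Open Scope classical_set_scope.
Local Open Scope ring_scope.
Local Open Scope charge_scope.

(* Finite signed measures are the library's charges, which take finite values
   on measurable sets. *)
Section affine.
Context d (T : measurableType d) (R : realType).
Implicit Types (mu nu p : {charge set T -> \bar R}).

Definition affine_comb (l : R) mu nu : {charge set T -> \bar R} :=
  cadd (cscale l mu) (cscale (1 - l) nu).

Definition affine_set (H : set ({charge set T -> \bar R})) :=
  forall mu nu (l : R), H mu -> H nu -> H (affine_comb l mu nu).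

Definition extreme_point (C : set ({charge set T -> \bar R})) p :=
  C p /\ forall p' p'' (l : R), C p' -> C p'' -> 0 < l < 1 ->
    p = affine_comb l p' p'' -> p' = p /\ p'' = p.

Definition prob_charge (q : probability T R) : {charge set T -> \bar R} :=
  charge_of_finite_measure q.

Definition probability_measures : set ({charge set T -> \bar R}) :=
  range prob_charge.

(* To be used for a probability p with p `<< q. The Radon-Nikodym derivative is
   only determined, and only known to be nonnegative, outside a q-null set,
   which does not affect the integral; so the values of phi on negative numbers
   are irrelevant. *)
Definition phi_divergence (phi : R -> R) p (q : probability T R) : R :=
  \int[q]_x phi (fine (('d p '/d q) x)).

(* The topology inherited from R^T: when T is finite with all sets measurable,
   a charge is determined by its values on the singletons. *)
Definition mass mu : {ptws T -> R} := fun x => fine (mu [set x]).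

Definition relatively_open (M U : set ({charge set T -> \bar R})) :=
  exists2 V : set {ptws T -> R}, open V & U = M `&` mass @^-1` V.

Definition strict_local_maximizer (M : set ({charge set T -> \bar R}))
    (F : {charge set T -> \bar R} -> R) p :=
  M p /\ exists U, [/\ relatively_open M U, U p &
    forall p', U p' -> p' <> p -> F p' < F p].

End affine.

(* Main.v *)
From HB Require Import structures.
Require Import Defs.
From mathcomp Require Import all_boot all_order all_algebra.
From mathcomp Require Import all_classical all_reals all_analysis.
From mathcomp Require Import ring lra.

(** Write M for the set of probability measures in H, a convex set. On a finite
discrete space a charge is the function of its masses on points, and
D p is the sum over x of q(x) * phi (p(x) / q(x)), so D is convex on M
([phi_divergence_convex]).

Part a): for each point that some element of M charges, choose such an
element; averaging these one at a time gives an element of M that charges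
every point which any element of M charges ([polytope_dominating]).

In part b) both (ii) and (iii) are consequences of one estimate for an extreme
point p. Let m(p') be the mass that p' gives to the null points of p. If
p + v is in H, v has total mass 0 and v vanishes on the null points of p, then
p + e v and p - e v are in M for small e > 0, so extremality forces v = 0
([extreme_direction]). Hence the null points separate the differences p' - p,
and by elementary linear algebra |p'(x) - p(x)| <= C(x) m(p') for all p' in M
([coordinates_control], [extreme_control]); in particular m(p') > 0 unless
p' = p. When p' is close to p, a point charged by p contributes at most
a constant times |p'(x) - p(x)| to D p' - D p, because a convex function is
bounded above by a cone near an interior point ([upper_slopeP]). A null point
contributes at most - K p'(x), with K as large as desired, because phi has
slope -oo at 0 ([steep_at0]). The second effect wins, so
D p' - D p <= - K m(p') near p ([extreme_decrease]). With K = 1 this is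
(iii); along the segment from p to p' the mass m is proportional to 1 - l, and
letting K vary gives (ii).

Conversely, if p is not extreme, it is t p1 + (1 - t) p2 with p1 and p2 in M
both different from p, and then it is also the same combination of the points
l p + (1 - l) p1 and l p + (1 - l) p2, for every l. By convexity D cannot be
smaller than D p at both of them ([nonextreme_chord]), which contradicts
(ii) as well as (iii) when l tends to 1. *)

Set Implicit Arguments.
Unset Strict Implicit.
Unset Printing Implicit Defensive.

Import Order.TTheory GRing.Theory Num.Theory.
Import numFieldNormedType.Exports.

Local Open Scope classical_set_scope.
Local Open Scope ring_scope.

(** * Filters, pointwise convergence and spaces of functions *)

Lemma near_seq (I : eqType) (T : Type) (F : set_system T) {FF : Filter F}
    (P : I -> T -> Prop) (s : seq I) :
  (forall i, i \in s -> \forall t \near F, P i t) ->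
  \forall t \near F, forall i, i \in s -> P i t.
Proof.
elim: s => [|a s IH] h; first by near=> t => i; rewrite in_nil.
have := IH (fun i si => h i (mem_behead (s := a :: s) si)).
apply: filterS2 (h a (mem_head a s)) => t Pa Ps i.
by rewrite in_cons => /predU1P[->//|]; exact: Ps.
Unshelve. all: end_near. Qed.

Lemma cvg_ptws (I : choiceType) (K : topologicalType) (T : Type)
    (F : set_system T) {FF : Filter F} (f : T -> {ptws I -> K})
    (g : {ptws I -> K}) :
  (forall i, f t i @[t --> F] --> g i) -> f t @[t --> F] --> g.
Proof.
move=> fg; apply/cvg_sup => i; rewrite cvg_image; last first.
  by rewrite eqEsubset; split=> v // _; exists (cst v).
move=> W /fg fW; exists (@^~ i @^-1` W) => //.
by rewrite eqEsubset; split => [_ [u Wu <-//]|w Ww]; exists (cst w).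
Qed.

Lemma near_coordinate (I : choiceType) (K : topologicalType)
    (g : {ptws I -> K}) (i : I) (U : set K) :
  nbhs (g i) U -> nbhs g [set u : {ptws I -> K} | U (u i)].
Proof. exact: (@proj_continuous I (fun=> K) i g). Qed.

(** Linear algebra without bases: a space of functions in which finitely many
coordinates determine the others has each coordinate bounded linearly by
those. Induction on the number of coordinates: either the new coordinate a
vanishes on V, or some w in V has w a != 0, and subtracting a multiple of w
from v leads to the subspace where the coordinate a vanishes. *)
Lemma coordinates_control (R : realFieldType) (T : eqType)
    (V : set (T -> R)) (s : seq T) :
  (forall (a : R) (v w : T -> R), V v -> V w -> V (fun x => v x - a * w x)) ->
  (forall v, V v -> (forall x, x \in s -> v x = 0) -> forall y, v y = 0) ->
  exists C : T -> R, forall v, V v -> forall y,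
    `|v y| <= C y * \sum_(x <- s) `|v x|.
Proof.
elim: s V => [|a s IH] V Vlin Vsep.
  exists (fun=> 0) => v Vv y.
  by rewrite (Vsep v Vv) ?normr0 ?mul0r.
have [||C0 C0P] := IH [set v | V v /\ v a = 0].
- move=> b v w [Vv va] [Vw wa]; split; first exact: Vlin.
  by rewrite va wa mulr0 subr0.
- move=> v [Vv va] v0 y; apply: Vsep => // x.
  by rewrite in_cons => /predU1P[->//|/v0].
pose C y := `|C0 y|.
have CP v : V v -> v a = 0 -> forall y, `|v y| <= C y * \sum_(x <- s) `|v x|.
  move=> Vv va y; apply: (le_trans (C0P v (conj Vv va) y)).
  by rewrite ler_wpM2r ?ler_norm// sumr_ge0.
have [[w Vw wa]|nw] := pselect (exists2 w, V w & w a != 0); last first.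
  exists C => v Vv y; rewrite big_cons.
  have va : v a = 0.
    by apply/eqP; apply: contra_notT nw => va; exists v.
  by rewrite va normr0 add0r; exact: CP.
pose N := \sum_(x <- s) `|w x|.
exists (fun y => C y + `|w y| / `|w a| + C y * (N / `|w a|)) => v Vv y.
rewrite big_cons; set S := \sum_(x <- s) `|v x|.
pose b := v a / w a.
pose u x := v x - b * w x.
have Vu : V u by exact: Vlin.
have ua : u a = 0 by rewrite /u /b divfK// subrr.
have b0 : `|b| = `|v a| / `|w a| by rewrite normrM normfV.
have -> : v y = u y + b * w y by rewrite /u subrK.
have uS : \sum_(x <- s) `|u x| <= S + `|b| * N.
  rewrite mulr_sumr -big_split/=; apply: ler_sum => x _.
  by rewrite -normrM ler_normB.
have C0' : 0 <= C y by exact: normr_ge0.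
have S0 : 0 <= S by exact: sumr_ge0.
have N0 : 0 <= N by exact: sumr_ge0.
apply: (le_trans (ler_normD _ _)); rewrite normrM.
have := le_trans (CP u Vu ua y) (ler_wpM2l C0' uS).
rewrite b0; have : 0 <= `|w a|^-1 by rewrite invr_ge0.
have := normr_ge0 (v a); have := normr_ge0 (w y).
move: `|w a|^-1 `|v a| `|w y| `|u y| => c e f g f0 e0 c0 h.
have {}h : g + e * c * f <= C y * (S + e * c * N) + e * c * f by rewrite lerD2r.
apply: (le_trans h); rewrite -subr_ge0.
have -> : (C y + f * c + C y * (N * c)) * (e + S) -
  (C y * (S + e * c * N) + e * c * f) =
  C y * e + f * c * S + C y * (N * c) * S by ring.
by rewrite !addr_ge0 ?mulr_ge0.
Qed.

(** * Convex functions on the half-line *)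

Section half_line.
Context (R : realType) (phi : R -> R).
Hypothesis convex_phi : convex_function (`[0, +oo[%classic : set R) phi.

Lemma convex_half_line (l x y : R) : 0 <= l <= 1 -> 0 <= x -> 0 <= y ->
  phi (l * x + (1 - l) * y) <= l * phi x + (1 - l) * phi y.
Proof.
move=> l01 x0 y0.
case/andP: l01 => l0 l1.
have := @convex_phi (Itv01 l0 l1) x y.
by rewrite !inE/= !in_itv/= !andbT => /(_ x0 y0).
Qed.

(** The chords of phi from a to 2 a and from a to 0 both have length a in the
horizontal direction; their two absolute slopes are added instead of compared,
which keeps the definition free of a maximum. *)
Definition upper_slope (a : R) :=
  (`|phi (2 * a) - phi a| + `|phi 0 - phi a|) / a.

(** On [0, 2 a] the graph of phi lies below its chords joining a to 0 and to
2 a. *)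
Lemma upper_slopeP (a s : R) : 0 < a -> `|s - a| <= a ->
  phi s - phi a <= upper_slope a * `|s - a|.
Proof.
move=> a0 sa; pose t := `|s - a| / a.
have t01 : 0 <= t <= 1.
  by rewrite /t ler_pdivlMr// mul0r ler_pdivrMr// mul1r normr_ge0.
have -> : upper_slope a * `|s - a| =
    t * (`|phi (2 * a) - phi a| + `|phi 0 - phi a|).
  by rewrite /upper_slope /t; ring.
have chord (b : R) : 0 <= b -> s = t * b + (1 - t) * a ->
    `|phi b - phi a| <= `|phi (2 * a) - phi a| + `|phi 0 - phi a| ->
    phi s - phi a <= t * (`|phi (2 * a) - phi a| + `|phi 0 - phi a|).
  move=> b0 sE bD; have := convex_half_line t01 b0 (ltW a0).
  rewrite -sE => ph; apply: (@le_trans _ _ (t * (phi b - phi a))).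
    by lra.
  case/andP: t01 => t0 _; rewrite ler_wpM2l//.
  by apply: le_trans bD; exact: ler_norm.
have [sa0|sa0] := leP a s.
- apply: (chord (2 * a)); rewrite ?lerDl ?pmulr_rge0 ?(ltW a0)//.
  by rewrite /t ger0_norm ?subr_ge0//; field; rewrite gt_eqF.
- apply: (chord 0 (lexx 0)); rewrite ?lerDr//.
  by rewrite /t ltr0_norm ?subr_lt0//; field; rewrite gt_eqF.
Qed.

Lemma upper_slope_ge0 (a : R) : 0 <= a -> 0 <= upper_slope a.
Proof. by move=> a0; rewrite divr_ge0 ?addr_ge0. Qed.

(** In terms of the perspective y |-> w phi (y / w), whose slope at 0 is that of
phi whatever w is. *)
Lemma steep_at0 : (phi t - phi 0) / t @[t --> 0^'+] --> -oo ->
  forall K w : R, 0 < w -> \forall e \near 0^'+, forall y, 0 <= y <= e ->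
    w * phi (y / w) - w * phi 0 <= - (K * y).
Proof.
move=> /cvgrNyPle steep K w w0.
have := steep (- K); rewrite near_withinE => -[r /= r0 rP].
have : 0 < r / 2 * w by rewrite mulr_gt0// divr_gt0.
move=> /nbhs_right_ltW; apply: filterS => e er y /andP[y0 ye].
have [->|yN0] := eqVneq y 0; first by rewrite mul0r subrr mulr0 oppr0.
have a0 : 0 < y / w by rewrite divr_gt0// lt_def yN0.
have ar : y / w < r.
  rewrite ltr_pdivrMr//; apply: (le_lt_trans (le_trans ye er)).
  by rewrite ltr_pM2r//; lra.
have := rP (y / w); rewrite /= sub0r normrN gtr0_norm// => /(_ ar a0).
rewrite ler_pdivrMr// => slope.
have := ler_wpM2l (ltW w0) slope; rewrite mulrBr => /le_trans; apply.
have -> : w * (- K * (y / w)) = - (K * y) by field; rewrite gt_eqF.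
exact: lexx.
Qed.

End half_line.

(** * Charges on a finite discrete space *)

Lemma charge_ext (R : realType) (d : measure_display) (T : measurableType d)
    (mu nu : {charge set T -> \bar R}) : mu =1 nu -> mu = nu.
Proof.
case: mu nu => [mu [[m1] [m2] [m3]]] [nu [[n1] [n2] [n3]]] /= /funext mn.
subst nu; congr (Charge.Pack (Charge.Class _ _ _)).
- by congr isSemiSigmaAdditive.Axioms_; exact: Prop_irrelevance.
- by congr isAdditiveCharge.Axioms_; exact: Prop_irrelevance.
- by congr isFinite.Axioms_; exact: Prop_irrelevance.
Qed.

Lemma set_seq_cons (T : eqType) (a : T) (t : seq T) :
  [set` a :: t] = a |` [set` t].
Proof.
by apply/seteqP; split => x /=; rewrite in_cons; [move/predU1P|move/predU1P].
Qed.

Section finite_space.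
Context (R : realType) (d : measure_display) (T : measurableType d).
Hypothesis discrete : forall A : set T, measurable A.
Variable s : seq T.
Hypotheses (uniq_s : uniq s) (mem_s : forall x, x \in s).
Implicit Types (mu nu p : {charge set T -> \bar R}) (q : probability T R).

Lemma fin_num_charge mu A : mu A \is a fin_num.
Proof. exact: fin_num_measure. Qed.

Lemma massE mu x : mu [set x] = (mass mu x)%:E.
Proof. by rewrite /mass fineK ?fin_num_charge. Qed.

Lemma charge_seq mu (t : seq T) : uniq t ->
  mu [set` t] = (\sum_(x <- t) mass mu x)%:E.
Proof.
elim: t => [_|a t IH /= /andP[at_ ut]].
  by rewrite big_nil set_nil charge0.
rewrite set_seq_cons chargeU//; last first.
  by apply/seteqP; split => // x [/= -> xt]; rewrite xt in at_.
by rewrite IH// big_cons EFinD massE.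
Qed.

Lemma charge_mass mu A :
  mu A = (\sum_(x <- s | x \in A) mass mu x)%:E.
Proof.
rewrite -big_filter -charge_seq ?filter_uniq//; congr (mu _).
by apply/seteqP; split => x /=; rewrite mem_filter mem_s andbT inE.
Qed.

Lemma charge_setT mu : mu setT = (\sum_(x <- s) mass mu x)%:E.
Proof. by rewrite charge_mass; under eq_bigl do rewrite in_setT. Qed.

Lemma mass_inj mu nu : (forall x, mass mu x = mass nu x) -> mu = nu.
Proof.
move=> mn; apply: charge_ext => A; rewrite !charge_mass; congr EFin.
exact: eq_bigr.
Qed.

Lemma mass_affine_comb l mu nu x :
  mass (affine_comb l mu nu) x = l * mass mu x + (1 - l) * mass nu x.
Proof.
transitivity (fine (l%:E * mu [set x] + (1 - l)%:E * nu [set x])%E) => //.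
by rewrite !massE -!EFinM -EFinD.
Qed.

(** Turns membership in the set of probability measures, which asks for a
measure structure, into finitely many linear conditions on the masses. *)
Lemma probability_measuresP p : probability_measures p <->
  (forall x, 0 <= mass p x) /\ \sum_(x <- s) mass p x = 1.
Proof.
split=> [[q _ <-]|[p0 p1]].
  split=> [x|]; first by rewrite /mass fine_ge0.
  by apply: EFin_inj; rewrite -charge_setT; exact: probability_setT.
have p_ge0 A : (0 <= p A)%E.
  by rewrite charge_mass lee_fin sumr_ge0.
pose m : {measure set T -> \bar R} := measure_of_charge p p_ge0.
have m1 : m setT = 1%E by rewrite /m /= /measure_of_charge charge_setT p1.
pose mP := Measure_isProbability.Build d T R m m1.
pose q : probability T R := HB.pack (Measure.sort m) (Measure.class m) mP.
by exists q => //; apply: charge_ext.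
Qed.

Lemma mass_le1 p x : probability_measures p -> mass p x <= 1.
Proof.
move=> /probability_measuresP[p0 <-].
by rewrite (bigD1_seq x)//= lerDl sumr_ge0.
Qed.

Lemma null_dominates_mass p q :
  p `<< q <-> forall x, mass (prob_charge q) x = 0 -> mass p x = 0.
Proof.
rewrite null_content_dominatesP; split=> [pq x qx|pq A _ qA].
  have := pq [set x] (discrete _).
  have := massE (prob_charge q) x.
  rewrite qx /= /prob_charge/= => -> /(_ erefl).
  by rewrite massE => -[].
rewrite charge_mass big1// => x /set_mem Ax; apply: pq.
have : (q [set x] <= q A)%E.
  by apply: le_measure; rewrite ?inE//; move=> y ->.
rewrite qA => qx; have q0 : q [set x] = 0%E.
  by apply/eqP; rewrite eq_le qx measure_ge0.
exact: (congr1 fine q0).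
Qed.

Lemma integrable_discrete q (f : T -> R) : q.-integrable setT (EFin \o f).
Proof.
apply: measurable_bounded_integrable => //.
  by rewrite (le_lt_trans (probability_le1 q _))// ltry.
exists (\sum_(x <- s) `|f x|); split => /=; first exact: num_real.
move=> M fM x _ /=; apply: le_trans (ltW fM).
by rewrite (bigD1_seq x)//= lerDl sumr_ge0.
Qed.

Lemma Rintegral_seq q (f : T -> R) (t : seq T) : uniq t ->
  \int[q]_(x in [set` t]) f x =
  \sum_(x <- t) mass (prob_charge q) x * f x.
Proof.
elim: t => [_|a t IH /= /andP[at_ ut]].
  by rewrite big_nil set_nil Rintegral_set0.
rewrite set_seq_cons Rintegral_setU//; last 2 first.
- exact: integrableS (integrable_discrete q f).
- by apply/disj_setPS => x [/= -> xt]; rewrite xt in at_.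
rewrite IH// big_cons; congr (_ + _).
rewrite (eq_Rintegral q (g := cst (f a))); last by move=> x /set_mem ->.
by rewrite Rintegral_cst// mulrC.
Qed.

Lemma Rintegral_discrete q (f : T -> R) :
  \int[q]_x f x = \sum_(x <- s) mass (prob_charge q) x * f x.
Proof.
have <- : [set` s] = [set: T] by apply/seteqP; split => x //= _; exact: mem_s.
exact: Rintegral_seq.
Qed.

Lemma Radon_Nikodym_mass p q x : p `<< q ->
  mass p x = mass (prob_charge q) x * fine (Radon_Nikodym p q x).
Proof.
move=> pq; have := Radon_Nikodym_integral pq (discrete [set x]).
rewrite (eq_integral (cst (Radon_Nikodym p q x))); last first.
  by move=> y /set_mem ->.
rewrite integral_cst//.
have := massE (prob_charge q) x; rewrite /= /prob_charge/= => ->.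
rewrite -[X in (X * _)%E]fineK; last exact: Radon_Nikodym_fin_num.
by rewrite massE => -[]; rewrite mulrC.
Qed.

(** Integrating the Radon-Nikodym derivative over a point x shows that it is
mass p x / mass q x there if q charges x; the other points have weight 0, so
the convention for division by 0 does not matter. *)
Lemma phi_divergenceE (phi : R -> R) p q : p `<< q ->
  phi_divergence phi p q = \sum_(x <- s)
    mass (prob_charge q) x * phi (mass p x / mass (prob_charge q) x).
Proof.
move=> pq; rewrite /phi_divergence Rintegral_discrete; apply: eq_bigr => x _.
have [->|qx] := eqVneq (mass (prob_charge q) x) 0; first by rewrite !mul0r.
by rewrite (Radon_Nikodym_mass x pq) mulrAC divff// mul1r.
Qed.

End finite_space.

(** * Probability measures in an affine set *)

Section polytope.
Context (R : realType) (d : measure_display) (T : measurableType d).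
Hypothesis discrete : forall A : set T, measurable A.
Variable s : seq T.
Hypotheses (uniq_s : uniq s) (mem_s : forall x, x \in s).
Variable H : set ({charge set T -> \bar R}).
Hypothesis affine_H : affine_set H.
Implicit Types (mu nu p : {charge set T -> \bar R}).

Let probP p := probability_measuresP discrete uniq_s mem_s p.
Let massD l mu nu := mass_affine_comb discrete l mu nu.
Let mass_eq mu nu := mass_inj (mu := mu) (nu := nu) discrete uniq_s mem_s.
Let dominatesP p (q : probability T R) :=
  null_dominates_mass discrete uniq_s mem_s p q.

Definition polytope : set ({charge set T -> \bar R}) :=
  @probability_measures d T R `&` H.
Local Notation M := polytope.

Lemma sum_mass_affine_comb l mu nu :
  \sum_(x <- s) mass (affine_comb l mu nu) x =
  l * \sum_(x <- s) mass mu x + (1 - l) * \sum_(x <- s) mass nu x.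
Proof.
by rewrite !mulr_sumr -big_split; apply: eq_bigr => x _; rewrite massD.
Qed.

Lemma polytope_convex l p p' : M p -> M p' -> 0 <= l <= 1 ->
  M (affine_comb l p p').
Proof.
move=> [/probP[p0 p1] Hp] [/probP[p'0 p'1] Hp'] /andP[l0 l1].
split; last exact: affine_H.
apply/probP; split=> [x|]; last by rewrite sum_mass_affine_comb p1 p'1; ring.
by rewrite massD addr_ge0 ?mulr_ge0 ?subr_ge0.
Qed.

(** Two elements of M have a midpoint that charges every point charged by one
of them, so the points can be treated one after the other. *)
Lemma polytope_dominating : M !=set0 ->
  exists q : probability T R, M (prob_charge q) /\ forall p, M p -> p `<< q.
Proof.
case=> p0 Mp0.
suff [p [Mp pP]] : exists p, M p /\ forall x, x \in s ->
    forall p', M p' -> mass p x = 0 -> mass p' x = 0.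
  have [[q _ qp] Hp] := Mp; exists q; rewrite qp; split=> // p' Mp'.
  apply/dominatesP => x; rewrite qp.
  exact: pP.
have : {subset s <= s} by [].
elim: {1 3}s => [_|a t IH ats]; first by exists p0.
have [|p [Mp pP]] := IH.
  by move=> x xt; apply: ats; rewrite in_cons xt orbT.
have [[p' Mp' p'a]|na] := pselect (exists2 p', M p' & mass p' a != 0);
  last first.
  exists p; split=> // x; rewrite in_cons => /predU1P[->|/pP//] p' Mp' _.
  by apply/eqP; apply: contra_notT na => ?; exists p'.
exists (affine_comb (2^-1) p p'); split.
  by apply: polytope_convex => //; apply/andP; split; lra.
have [/probP[p_ge0 _] _] := Mp; have [/probP[p'_ge0 _] _] := Mp'.
move=> x; rewrite massD in_cons => + p'' Mp'' px.
have {px}[px p'x] : mass p x = 0 /\ mass p' x = 0.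
  by have := p_ge0 x; have := p'_ge0 x; split; lra.
case/predU1P => [xa|xt]; first by rewrite xa in p'x; rewrite p'x eqxx in p'a.
exact: (pP x xt).
Qed.

Section extreme.
Variable p : {charge set T -> \bar R}.
Hypothesis extreme_p : extreme_point M p.

Let Mp : M p. Proof. by case: extreme_p. Qed.
Let p_ge0 x : 0 <= mass p x. Proof. by case: Mp => /probP[]. Qed.

(** The linear space parallel to the affine set H. *)
Definition direction (v : T -> R) := exists2 nu, H nu &
  forall x, v x = mass nu x - mass p x.

Definition null_support := [seq x <- s | mass p x == 0].

Lemma direction_linear a (v w : T -> R) : direction v -> direction w ->
  direction (fun x => v x - a * w x).
Proof.
move=> [nu Hnu vE] [mu Hmu wE]; have Hp := Mp.2.
(* the midpoint of p + 2 v and p - 2 a w is p + v - a w *)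
exists (affine_comb (2^-1) (affine_comb 2 nu p)
  (affine_comb (1 + 2 * a) p mu)).
  by do 2?apply: affine_H => //.
by move=> x; rewrite !massD vE wE; field.
Qed.

(** If v were nonzero, p would be the midpoint of p + e v and p - e v, which
stay nonnegative for small e because v vanishes where p does. *)
Lemma extreme_direction (v : T -> R) : direction v ->
  \sum_(x <- s) v x = 0 ->
  (forall x, x \in null_support -> v x = 0) -> forall x, v x = 0.
Proof.
move=> [nu Hnu vE] sv v0; have [_ Hp] := Mp.
have p1 : \sum_(x <- s) mass p x = 1 by case: Mp => /probP[].
have near_ge0 x : x \in s -> \forall e \near 0^'+, e * `|v x| <= mass p x.
  move=> _; have [px0|px] := eqVneq (mass p x) 0.
    by apply: nearW => e; rewrite v0 ?normr0 ?mulr0// mem_filter px0 eqxx mem_s.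
  have [->|vx] := eqVneq (v x) 0.
    by apply: nearW => e; rewrite normr0 mulr0.
  have : 0 < mass p x / `|v x| by rewrite divr_gt0 ?normr_gt0// lt_def px p_ge0.
  move=> /nbhs_right_ltW; apply: filterS => e.
  by rewrite ler_pdivlMr// normr_gt0.
have : \forall e \near 0^'+,
    0 < e /\ forall x, x \in s -> e * `|v x| <= mass p x.
  by apply: filterI; [exact: nbhs_right_gt|exact: near_seq near_ge0].
move=> /filter_ex[e [e0 ev]].
have mass_sum : \sum_(x <- s) mass nu x = 1.
  rewrite -p1; apply/eqP; rewrite -subr_eq0 -sumrB -[X in _ == X]sv.
  by apply/eqP/eq_bigr => x _; rewrite vE.
have Mshift c : `|c| <= e -> M (affine_comb (1 - c) p nu).
  move=> ce; split; last exact: affine_H.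
  apply/probP; split=> [x|]; last first.
    by rewrite sum_mass_affine_comb p1 mass_sum; ring.
  have : `|c * v x| <= mass p x.
    by rewrite normrM (le_trans _ (ev x _))// ler_wpM2r.
  by rewrite massD ler_norml vE => /andP[]; lra.
have [_ ext] := extreme_p.
have [] := ext (affine_comb (1 - e) p nu) (affine_comb (1 - (- e)) p nu) 2^-1.
- by apply: Mshift; rewrite ger0_norm// ltW.
- by apply: Mshift; rewrite normrN ger0_norm// ltW.
- by apply/andP; split; lra.
- by apply: mass_eq => x; rewrite !massD; field.
move=> pE _ x; have := congr1 (fun mu => mass mu x) pE.
rewrite /= massD vE => h; apply: (@mulfI _ e); first by rewrite gt_eqF.
by lra.
Qed.

(** The mass of p' on the null points of p; it measures how far p' is from an
extreme point p. *)
Definition null_mass p' := \sum_(x <- null_support) mass p' x.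

Lemma null_mass_ge0 p' : M p' -> 0 <= null_mass p'.
Proof. by move=> [/probP[p'0 _] _]; exact: sumr_ge0. Qed.

(** By extremality, no direction of H with total mass 0 vanishes at all null
points of p except 0, so their coordinates control the others; at those points
p' - p is just p', hence the null mass of p' is the controlling sum. *)
Lemma extreme_control : exists C : T -> R, forall p', M p' -> forall x,
  `|mass p' x - mass p x| <= C x * null_mass p'.
Proof.
have [||C CP] := @coordinates_control R T
    [set v | direction v /\ \sum_(x <- s) v x = 0] null_support.
- move=> a v w [dv sv] [dw sw]; split; first exact: direction_linear.
  by rewrite sumrB -mulr_sumr sv sw mulr0 subrr.
- by move=> v [dv sv]; exact: extreme_direction.
exists C => p' [/probP[p'0 p'1] Hp'] x.
have p1 : \sum_(x <- s) mass p x = 1 by case: Mp => /probP[].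
have := CP (fun x => mass p' x - mass p x) _ x => /=.
have -> : \sum_(y <- null_support) `|mass p' y - mass p y| = null_mass p'.
  rewrite /null_mass big_seq_cond [RHS]big_seq_cond; apply: eq_bigr => y.
  by rewrite andbT mem_filter => /andP[/eqP -> _]; rewrite subr0 ger0_norm.
by apply; split; [exists p'|rewrite sumrB p1 p'1 subrr].
Qed.

Lemma null_mass_gt0 p' : M p' -> p' <> p -> 0 < null_mass p'.
Proof.
move=> Mp' p'p; rewrite lt_def null_mass_ge0// andbT; apply/eqP => p'0.
apply: p'p; apply: mass_eq => x; have [C /(_ _ Mp' x)] := extreme_control.
by rewrite p'0 mulr0 normr_le0 subr_eq0 => /eqP.
Qed.

End extreme.

(** * The divergence near extreme and non-extreme points *)

Section divergence.
Variables (q : probability T R) (phi : R -> R).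
Hypothesis dominating_q : forall p, M p -> p `<< q.
Hypothesis convex_phi : convex_function (`[0, +oo[%classic : set R) phi.
Local Notation w := (mass (prob_charge q)).
Local Notation D p := (phi_divergence phi p q).

Let w_ge0 x : 0 <= w x. Proof. by rewrite /mass fine_ge0. Qed.
Let DE p : M p -> D p = \sum_(x <- s) w x * phi (mass p x / w x).
Proof. by move=> /dominating_q; exact: phi_divergenceE. Qed.

Lemma phi_divergence_convex l p p' : M p -> M p' -> 0 <= l <= 1 ->
  D (affine_comb l p p') <= l * D p + (1 - l) * D p'.
Proof.
move=> Mp Mp' l01; rewrite !DE//; last exact: polytope_convex.
have [/probP[p_ge0 _] _] := Mp; have [/probP[p'_ge0 _] _] := Mp'.
rewrite !mulr_sumr -big_split; apply: ler_sum => x _ /=.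
rewrite massD mulrDl -!mulrA [X in _ <= X + _]mulrCA.
rewrite [X in _ <= _ + X]mulrCA -mulrDr.
apply: ler_wpM2l => //.
by apply: convex_half_line => //; rewrite divr_ge0.
Qed.

Hypothesis steep_phi : (phi t - phi 0) / t @[t --> 0^'+] --> -oo.

(** The decrease at the null points is null_mass times an arbitrarily large
factor and outweighs the increase at the other points, which is at most
a fixed multiple of null_mass by the linear control. *)
Lemma extreme_decrease p : extreme_point M p -> forall K : R,
  \forall e \near 0^'+, forall p', M p' ->
    (forall x, `|mass p' x - mass p x| <= e) ->
    D p' - D p <= - K * null_mass p p'.
Proof.
move=> extp K; have [Mp _] := extp; have [/probP[p_ge0 _] _] := Mp.
have [C CP] := extreme_control extp.
(* B x * null_mass bounds the increase at x; B x is 0 at the null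
   points, where upper_slope phi 0 = 0 because of the division by 0 *)
pose B x := upper_slope phi (mass p x / w x) * C x.
(* the decrease must outweigh the total increase by K *)
pose K' := K + \sum_(x <- s) B x.
suff term x : x \in s -> \forall e \near 0^'+, forall p', M p' ->
    `|mass p' x - mass p x| <= e ->
    w x * phi (mass p' x / w x) - w x * phi (mass p x / w x) <=
    B x * null_mass p p' - (if mass p x == 0 then K' * mass p' x else 0).
  apply: filterS (near_seq term) => e eP p' Mp' p'p.
  rewrite !DE// -sumrB.
  have : \sum_(x <- s)
      (w x * phi (mass p' x / w x) - w x * phi (mass p x / w x))
    <= \sum_(x <- s) (B x * null_mass p p' -
         (if mass p x == 0 then K' * mass p' x else 0)).
    rewrite big_seq [leRHS]big_seq; apply: ler_sum => x xs; exact: eP.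
  move=> /le_trans; apply; rewrite sumrB -mulr_suml -big_mkcond -mulr_sumr.
  by rewrite -[X in K' * X]big_filter -/(null_mass p p') /K'; lra.
move=> _; have [px0|px] := eqVneq (mass p x) 0.
- have slope0 : B x = 0 by rewrite /B /upper_slope px0 mul0r invr0 !mulr0 mul0r.
  have [wx0|wx] := eqVneq (w x) 0.
    apply: nearW => e p' Mp' _; rewrite wx0 !mul0r slope0 mul0r.
    have /dominatesP/(_ x wx0) -> := dominating_q Mp'.
    by rewrite mulr0 !subr0.
  have {}wx : 0 < w x by rewrite lt_def wx w_ge0.
  have := steep_at0 steep_phi K' wx.
  apply: filterS => e eP p' [/probP[p'_ge0 _] _].
  rewrite px0 subr0 ger0_norm// => p'e; rewrite mul0r slope0 mul0r sub0r.
  by apply: eP; rewrite p'_ge0.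
have {}px : 0 < mass p x by rewrite lt_def px p_ge0.
have wx : 0 < w x.
  rewrite lt_def w_ge0 andbT; apply: contraTneq px => wx0.
  have /dominatesP/(_ x wx0) -> := dominating_q Mp.
  by rewrite ltxx.
have := nbhs_right_ltW px; apply: filterS => e ep p' Mp' p'e.
rewrite subr0 -mulrBr.
have a0 : 0 < mass p x / w x by rewrite divr_gt0.
have aD : `|mass p' x / w x - mass p x / w x| = `|mass p' x - mass p x| / w x.
  by rewrite -mulrBl normrM normfV (gtr0_norm wx).
have := @upper_slopeP R phi convex_phi (mass p x / w x) (mass p' x / w x) a0.
rewrite aD ler_pM2r ?invr_gt0// => /(_ (le_trans p'e ep)) h.
apply: (le_trans (ler_wpM2l (ltW wx) h)).
rewrite /B -mulrA mulrCA; apply: ler_wpM2l; first exact/upper_slope_ge0/ltW.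
by rewrite mulrC divfK ?gt_eqF// CP.
Qed.

Lemma mass_segment_dist l p p' x : M p -> M p' -> 0 <= l <= 1 ->
  `|mass (affine_comb l p p') x - mass p x| <= 1 - l.
Proof.
move=> [Pp _] [Pp' _] /andP[l0 l1].
have := mass_le1 discrete uniq_s mem_s x Pp.
have := mass_le1 discrete uniq_s mem_s x Pp'.
have [/(_ x) + _] := (probP _).1 Pp; have [/(_ x) + _] := (probP _).1 Pp'.
rewrite massD => p'0 p0 p'1 p1.
rewrite (_ : _ - _ = (1 - l) * (mass p' x - mass p x)); last by ring.
rewrite normrM ger0_norm ?subr_ge0// ler_piMr ?subr_ge0//.
by rewrite ler_norml; apply/andP; split; lra.
Qed.

Lemma null_mass_segment l p p' :
  null_mass p (affine_comb l p p') = (1 - l) * null_mass p p'.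
Proof.
rewrite /null_mass mulr_sumr big_seq [RHS]big_seq; apply: eq_bigr => x.
by rewrite mem_filter massD => /andP[/eqP -> _]; rewrite mulr0 add0r.
Qed.

Let left1 : \forall l \near (1 : R)^'-, 0 <= l /\ l < 1.
Proof.
apply: filterI; last exact: nbhs_left_lt.
by apply: nbhs_left_ge; rewrite ltr01.
Qed.

Lemma extreme_slope p p' : extreme_point M p -> M p' -> p' <> p ->
  (D (affine_comb l p p') - D p) / (1 - l) @[l --> 1^'-] --> -oo.
Proof.
move=> extp Mp' p'p; have [Mp _] := extp.
have m0 := null_mass_gt0 extp Mp' p'p.
apply/cvgrNyPle => A.
(* null_mass is (1 - l) * null_mass p p' on the segment, so this factor makes
   the difference quotient at most A *)
have := extreme_decrease extp (- A / null_mass p p').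
move=> /(filterI (nbhs_right_gt 0))/filter_ex[e [e0 eP]].
have le : \forall l \near (1 : R)^'-, 1 - e <= l.
  by apply: nbhs_left_ge; rewrite ltrBlDr ltrDl.
apply: filterS2 left1 le => l [l0 l1] el.
have l01 : 0 <= l <= 1 by rewrite l0 ltW.
rewrite ler_pdivrMr ?subr_gt0//.
have := eP _ (polytope_convex Mp Mp' l01).
rewrite null_mass_segment => h; apply: le_trans (h _) _.
  move=> x; apply: le_trans (mass_segment_dist x Mp Mp' l01) _.
  by rewrite lerBlDr -lerBlDl.
rewrite le_eqVlt; apply/orP; left; apply/eqP; field.
by rewrite gt_eqF.
Qed.

Lemma extreme_strict_max p : extreme_point M p ->
  strict_local_maximizer M (fun p' => D p') p.
Proof.
move=> extp; have [Mp _] := extp; split=> //.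
have := extreme_decrease extp 1.
move=> /(filterI (nbhs_right_gt 0))/filter_ex[e [e0 eP]].
pose W : set {ptws T -> R} :=
  [set u | forall x, x \in s -> `|u x - mass p x| <= e].
have pW : W° (mass p).
  apply: (@near_seq T {ptws T -> R} (nbhs (mass p)) _
    (fun x u => `|u x - mass p x| <= e)) => x _.
  apply: (@near_coordinate T R (mass p) x (fun y => `|y - mass p x| <= e)).
  have /cvgrPdist_le/(_ _ e0) : y @[y --> mass p x] --> mass p x.
    exact: cvg_id.
  by apply: filterS => y; rewrite distrC.
exists (M `&` @mass d T R @^-1` W°); split.
- by exists W° => //; exact: open_interior.
- by [].
move=> p' [Mp' /interior_subset p'W] p'p.
have := eP p' Mp' (fun x => p'W x (mem_s x)).
by have := null_mass_gt0 extp Mp' p'p; lra.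
Qed.

(** If p = t p1 + (1 - t) p2, the homothety of centre p and ratio 1 - l maps
this combination to another one that equals p, with the same t. *)
Lemma nonextreme_chord p : M p -> ~ extreme_point M p ->
  exists p1 p2 t, [/\ 0 < t < 1, M p1 /\ p1 <> p, M p2 /\ p2 <> p &
    forall l, 0 <= l <= 1 ->
    D p <= t * D (affine_comb l p p1) + (1 - t) * D (affine_comb l p p2)].
Proof.
move=> Mp; apply: contra_notP => nchord; split=> // p1 p2 t Mp1 Mp2 t01 pE.
have massE x : mass p x = t * mass p1 x + (1 - t) * mass p2 x.
  by rewrite {1}pE massD.
(* if one of p1 and p2 is p, then so is the other *)
have [p1p|p1p] := pselect (p1 = p).
  split=> //; apply: mass_eq => x; have := massE x; rewrite p1p => h.
  apply: (@mulfI _ (1 - t)).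
    by case/andP: t01 => _; rewrite subr_eq0; case: ltgtP.
  by lra.
have [p2p|p2p] := pselect (p2 = p).
  split=> //; apply: mass_eq => x; have := massE x; rewrite p2p => h.
  apply: (@mulfI _ t); first by case/andP: t01; case: ltgtP.
  by lra.
case: nchord; exists p1, p2, t; split=> // l l01.
have t01' : 0 <= t <= 1 by case/andP: t01 => ? ?; rewrite !ltW.
rewrite [X in D X <= _](_ : p =
    affine_comb t (affine_comb l p p1) (affine_comb l p p2)).
  by apply: phi_divergence_convex => //; exact: polytope_convex.
by apply: mass_eq => x; rewrite !massD massE; ring.
Qed.

(** The weighted mean of the difference quotients towards p1 and p2 is
nonnegative, so they cannot both tend to -oo. *)
Lemma slope_extreme p : M p ->
  (forall p', M p' -> p' <> p ->
    (D (affine_comb l p p') - D p) / (1 - l) @[l --> 1^'-] --> -oo) ->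
  extreme_point M p.
Proof.
move=> Mp slope; apply: contrapT => /(nonextreme_chord Mp).
move=> [p1 [p2 [t [/andP[t0 t1] [Mp1 p1p] [Mp2 p2p] chord]]]].
have /cvgrNyPle/(_ (-1)) slope1 := slope p1 Mp1 p1p.
have /cvgrNyPle/(_ (-1)) slope2 := slope p2 Mp2 p2p.
have [l [[l0 l1] []]] := filter_ex (filterI left1 (filterI slope1 slope2)).
rewrite !ler_pdivrMr ?subr_gt0// => h1 h2.
have := chord l; rewrite l0 ltW// => /(_ isT).
have : t * (D (affine_comb l p p1) - D p) <= t * (-1 * (1 - l)).
  by rewrite ler_pM2l.
have : (1 - t) * (D (affine_comb l p p2) - D p) <= (1 - t) * (-1 * (1 - l)).
  by rewrite ler_pM2l ?subr_gt0.
by lra.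
Qed.

Lemma strict_max_extreme p : strict_local_maximizer M (fun p' => D p') p ->
  extreme_point M p.
Proof.
move=> [Mp [_ [[V oV ->] [_ Vp] maxp]]]; apply: contrapT.
move=> /(nonextreme_chord Mp).
move=> [p1 [p2 [t [/andP[t0 t1] [Mp1 p1p] [Mp2 p2p] chord]]]].
have lower p' : M p' -> p' <> p ->
    \forall l \near (1 : R)^'-, D (affine_comb l p p') < D p.
  move=> Mp' p'p.
  have Vl : \forall l \near (1 : R)^'-, V (mass (affine_comb l p p')).
    suff : mass (affine_comb l p p') @[l --> (1 : R)^'-] --> mass p.
      by apply; exact: open_nbhs_nbhs.
    apply: cvg_ptws => x; apply/cvgrPdist_le => e e0.
    have le : \forall l \near (1 : R)^'-, 1 - e <= l.
      by apply: nbhs_left_ge; rewrite ltrBlDr ltrDl.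
    apply: filterS2 left1 le => l [l0 l1] el.
    rewrite distrC; apply: le_trans (mass_segment_dist x Mp Mp' _) _.
      by rewrite l0 ltW.
    by rewrite lerBlDr -lerBlDl.
  apply: filterS2 left1 Vl => l [l0 l1] Vl; apply: maxp.
    by split=> //; apply: polytope_convex => //; rewrite l0 ltW.
  move=> pE; apply: p'p; apply: mass_eq => x.
  have := congr1 (fun mu => mass mu x) pE; rewrite /= massD => h.
  apply: (@mulfI _ (1 - l)); first by rewrite subr_eq0 gt_eqF.
  by lra.
have [l [[l0 l1] [h1 h2]]] := filter_ex (filterI left1
  (filterI (lower p1 Mp1 p1p) (lower p2 Mp2 p2p))).
have := chord l; rewrite l0 ltW// => /(_ isT).
have : t * D (affine_comb l p p1) < t * D p by rewrite ltr_pM2l.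
have : (1 - t) * D (affine_comb l p p2) < (1 - t) * D p.
  by rewrite ltr_pM2l ?subr_gt0.
by lra.
Qed.

End divergence.
End polytope.

Theorem theorem3p1 (R : realType) (d : measure_display) (Omega : measurableType d)
    (finite_Omega : finite_set [set: Omega])
    (powerset_measurable : forall A : set Omega, measurable A)
    (H : set ({charge set Omega -> \bar R})) (affine_H : affine_set H) :
  let M := @probability_measures d Omega R `&` H in
  M !=set0 ->
  (exists q : probability Omega R, M (prob_charge q) /\
     (forall p', M p' -> p' `<< q)) /\
  (forall q : probability Omega R, M (prob_charge q) ->
   (forall p', M p' -> p' `<< q) ->
   forall phi : R -> R,
   convex_function (`[0, +oo[%classic : set R) phi ->
   phi 1 = 0 ->
   (phi s - phi 0) / s @[s --> 0^'+] --> -oo ->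
   forall p : {charge set Omega -> \bar R}, M p ->
   let D p' := phi_divergence phi p' q in
   let i := extreme_point M p in
   let ii := forall p', M p' -> p' <> p ->
     (D (affine_comb l p p') - D p) / (1 - l) @[l --> 1^'-] --> -oo in
   let iii := strict_local_maximizer M D p in
   (i <-> ii) /\ (ii <-> iii)).
Proof.
move=> M M0.
have [t tT] := (finite_seqP _).1 finite_Omega.
pose s := undup t.
have us : uniq s by exact: undup_uniq.
have ms x : x \in s.
  by rewrite mem_undup; have : [set: Omega] x by []; rewrite tT.
split; first exact: (polytope_dominating powerset_measurable us ms affine_H M0).
move=> q _ dom phi convex_phi _ steep p Mp D i ii iii.
have i_ii : i -> ii.
  move=> ip p' Mp' p'p.
  exact: (extreme_slope powerset_measurable us ms affine_H dom convex_phi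
    steep ip).
have ii_i : ii -> i :=
  slope_extreme powerset_measurable us ms affine_H dom convex_phi Mp.
have i_iii : i -> iii :=
  extreme_strict_max powerset_measurable us ms affine_H dom convex_phi
    steep (p := p).
have iii_i : iii -> i :=
  strict_max_extreme powerset_measurable us ms affine_H dom convex_phi
    (p := p).
by split; split => h;
  [exact: i_ii|exact: ii_i|exact/i_iii/ii_i|exact/i_ii/iii_i].
Qed.
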